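(* Let $p=c/n$ where $c>0$ is a constant, and let $k=k(n)$ be an arbitrary sequence of integers. There exists a constant $L>0$ such that $$\mathbb{P}\left(\alpha(G_{n,p})=k\right)\le Ln^{-1/2}$$ for $n$ sufficiently large.
   Context: $G_{n,p}$ is the binomial random graph on $n$ vertices in which each potential edge appears independently with probability $p$; $\alpha(G)$ is the independence number (maximum size of a set of vertices containing no edge). *)

(* Defs.v *)
From mathcomp Require Import all_boot all_order all_algebra.
From mathcomp Require Import reals exp.

Set Implicit Arguments.
Unset Strict Implicit.
Unset Printing Implicit Defensive.

Import Order.TTheory GRing.Theory Num.Theory.
Local Open Scope ring_scope.

(* A simple graph on the vertex set 'I_n is identified with its edge set, a set
   of two-element subsets of 'I_n. *)
Definition potential_edges (n : nat) : {set {set 'I_n}} :=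
  [set e : {set 'I_n} | #|e| == 2%N].

Definition graphs (n : nat) : {set {set {set 'I_n}}} :=
  powerset (potential_edges n).

Definition independent (n : nat) (G : {set {set 'I_n}}) (S : {set 'I_n}) : bool :=
  [forall e in G, ~~ (e \subset S)].

Definition independence_number (n : nat) (G : {set {set 'I_n}}) : nat :=
  \max_(S : {set 'I_n} | independent G S) #|S|.

(* Law of the binomial random graph: each potential edge independently
   contributes a factor p if present and 1 - p if absent. *)
Definition Gnp_weight (R : realType) (n : nat) (p : R)
    (G : {set {set 'I_n}}) : R :=
  \prod_(e in potential_edges n) (if e \in G then p else 1 - p).

Definition Gnp_prob (R : realType) (n : nat) (p : R)
    (A : pred {set {set 'I_n}}) : R :=
  \sum_(G in graphs n | A G) Gnp_weight p G.

(* Case F = set0: total mass 1.  The general case is the mutual independence of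
   the edge indicators, each with success probability p. *)
Lemma Gnp_prob_sub (R : realType) (n : nat) (p : R) (F : {set {set 'I_n}}) :
  F \subset potential_edges n ->
  Gnp_prob p (fun G => F \subset G) = p ^+ #|F|.
Proof.
set E := potential_edges n => sFE.
pose f e : R := if e \in E then p else 0.
pose g e : R := if e \in F then 0 else if e \in E then 1 - p else 1.
have -> : p ^+ #|F| = \prod_e (f e + g e).
  rewrite -prodr_const big_mkcond; apply: eq_bigr => e _; rewrite /f /g.
  case: ifP => [/(subsetP sFE) ->|_]; first by rewrite addr0.
  by case: ifP => _; rewrite ?subrKC ?add0r.
rewrite bigA_distr /Gnp_prob big_mkcond; apply: eq_bigr => G _.
rewrite powersetE.
case: ifP => [/andP[/subsetP sGE /subsetP sFG]|/nandP[]].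
- rewrite /Gnp_weight big_mkcond; apply: eq_bigr => e _; rewrite /f /g -/E.
  case: (boolP (e \in G)) => [/sGE -> //|eG].
  by rewrite (contraNF (@sFG e) eG).
- case/subsetPn => e eG eE; rewrite (bigD1 e) //= eG /f (negPf eE).
  by rewrite mul0r.
- case/subsetPn => e eF eG; rewrite (bigD1 e) //= (negPf eG) /g eF.
  by rewrite mul0r.
Qed.

(* Main.v *)
(* Expose the random graph in two rounds: G(n, p) is obtained from U ~ G(n, 2p)
   by keeping each edge with probability 1/2.  Given U, every isolated edge of U
   (an edge sharing no vertex with another edge) lowers the independence number
   by exactly 1 when it is kept, whatever happens elsewhere.  Hence, given U and
   the fate of its other edges, alpha is a constant minus a Bin(m, 1/2) variable,
   with m the number of isolated edges of U, and its atoms have mass at most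
   (m + 1)^(-1/2).  For p = c/n the mean of m is of order n, and Chebyshev's
   inequality bounds the probability that m is below half its mean by O(1/n). *)

Require Import Defs.
From mathcomp Require Import all_boot all_order all_algebra.
From mathcomp Require Import reals sequences exp.
From mathcomp Require Import zify ring lra.

Import Order.TTheory GRing.Theory Num.Theory.
Local Open Scope ring_scope.

(** * Atoms of Bin(m, 1/2): bounds on binomial coefficients *)

Lemma central_bin_sqr (t : nat) : ('C(t.*2, t) ^ 2 * t.*2.+1 <= 4 ^ t.*2)%N.
Proof.
elim: t => // t IH.
have H1 : (t.+1 * 'C(t.+1.*2, t.+1) = 2 * t.*2.+1 * 'C(t.*2, t))%N.
  have E1 := mul_bin_diag t.+1.*2 t.
  have E2 := mul_bin_diag t.*2.+1 t.
  have E3 : 'C(t.*2.+1, t.+1) = 'C(t.*2.+1, t).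
    by rewrite -bin_sub; [congr binomial; lia | lia].
  rewrite /= in E1 E2.
  have -> : t.+1.*2 = t.*2.+2 by lia.
  rewrite doubleS /= in E1.
  by rewrite -E1; nia.
(* The factor [t.+1 ^ 2] lets [H1] apply; what remains is (2t+1)(2t+3) <= (2t+2)^2. *)
rewrite -(leq_pmul2l (m := t.+1 ^ 2)) ?expn_gt0 //.
rewrite mulnA -expnMn H1 doubleS !expnS expn0 !muln1.
rewrite !expnS expn0 !muln1 in IH; nia.
Qed.

Lemma bin_le_half (m j : nat) : ('C(m, j) <= 'C(m, m./2))%N.
Proof.
have up k : (k.*2 < m -> 'C(m, k) <= 'C(m, k.+1))%N.
  move=> km; rewrite -(leq_pmul2l (m := k.+1)) // mul_bin_left leq_mul2r.
  by apply/orP; right; lia.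
have mono d k : (k + d = m./2 -> 'C(m, k) <= 'C(m, m./2))%N.
  elim: d k => [|d IH] k E; first by rewrite -E addn0.
  by apply: (leq_trans (up k _)); [lia | apply: IH; lia].
have [jm|mj] := leqP j m; last by rewrite bin_small.
have [h|h] := leqP j m./2; first exact: (mono (m./2 - j)%N _ (subnKC h)).
by rewrite -bin_sub //; apply: (mono (m./2 - (m - j))%N); lia.
Qed.

(** Squared form, within [nat], of the bound (m+1)^(-1/2) on the atoms of Bin(m, 1/2). The central
    coefficient is the worst case; odd m = 2t+1 reduces to even 2t+2 because C(2t+2, t+1) = 2
    C(2t+1, t). *)
Lemma bin_sqr_le (m j : nat) : ('C(m, j) ^ 2 * m.+1 <= 4 ^ m)%N.
Proof.
apply: (@leq_trans ('C(m, m./2) ^ 2 * m.+1)).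
  by rewrite leq_mul2r leq_exp2r ?bin_le_half ?orbT.
case: (boolP (odd m)) => om; last first.
  have := central_bin_sqr m./2; rewrite -[in X in _ -> X](odd_double_half m).
  by rewrite (negPf om) add0n doubleK.
have := central_bin_sqr m./2.+1.
have Em : m = m./2.*2.+1 by rewrite -{1}(odd_double_half m) om.
move: (m./2) Em => t ->.
have E : 'C(t.+1.*2, t.+1) = (2 * 'C(t.*2.+1, t))%N.
  rewrite doubleS binS -(@bin_sub t.*2.+1 t.+1); last lia.
  have -> : (t.*2.+1 - t.+1 = t)%N by lia.
  by rewrite addnn mul2n.
rewrite E doubleS !expnS expn0; nia.
Qed.

(** * Isolated edges and the independence number *)

Section Graph.
Set Implicit Arguments.
Variable n : nat.
Implicit Types (e f : {set 'I_n}) (G U I J : {set {set 'I_n}}).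
Local Notation E := (potential_edges n).

Lemma independence_number_attained G : G \subset E ->
  exists2 S, independent G S & #|S| = independence_number G.
Proof.
(* Edges of size 2 cannot lie inside [set0], so the maximum ranges over a nonempty family and is not
   the default 0. *)
move=> GE; have i0 : independent G set0.
  apply/forall_inP => e /(subsetP GE); rewrite inE subset0 => /eqP e2.
  by rewrite -cards_eq0 e2.
rewrite /independence_number (bigop.bigmax_eq_arg set0) //.
by case: arg_maxnP => // S iS _; exists S.
Qed.

Lemma independence_number_ge G S :
  independent G S -> (#|S| <= independence_number G)%N.
Proof. by move=> iS; rewrite /independence_number (bigD1 S) //= leq_maxl. Qed.

(** An independent set of [e |: G] misses an endpoint of [e], which can be added once [e] is
    dropped, as no edge of [G] touches it. Conversely, deleting an endpoint of [e] from an
    independent set of [G] makes it independent in [e |: G]. *)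
Lemma independence_number_add_isolated G e :
    e \in E -> G \subset E -> {in G, forall f, [disjoint f & e]} ->
  (independence_number (e |: G)).+1 = independence_number G.
Proof.
move=> eE GE dis; have eGE : e |: G \subset E by rewrite subUset sub1set eE.
have e2 : #|e| = 2 by apply/eqP; rewrite inE in eE.
apply/eqP; rewrite eqn_leq; apply/andP; split.
- have [S iS <-] := independence_number_attained eGE.
  move/forall_inP: iS => iS.
  have [x xe xS] := subsetPn (iS e (setU11 _ _)).
  rewrite -[_.+1]add1n -[1%N]/(true : nat) -xS -cardsU1.
  apply: independence_number_ge; apply/forall_inP => f fG.
  apply: contra (iS f (setU1r _ fG)) => /subsetP fS; apply/subsetP => y yf.
  have := fS _ yf; rewrite in_setU1 => /orP[/eqP yx|//].
  by have := disjointFr (dis f fG) yf; rewrite yx xe.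
- have [S iS <-] := independence_number_attained GE.
  move/forall_inP: iS => iS.
  have [x xe] : exists x, x \in e by apply/card_gt0P; rewrite e2.
  have : (#|S :\ x| <= independence_number (e |: G))%N.
    apply: independence_number_ge; apply/forall_inP => f.
    rewrite in_setU1 => /orP[/eqP ->|fG].
      by apply/subsetPn; exists x => //; rewrite setD11.
    by apply: contra (iS f fG) => fS; apply: (subset_trans fS); rewrite subD1set.
  have := cardsD1 x S; case: (x \in S); lia.
Qed.

(** Taken among all potential edges, independently of any graph, so that isolation of [e] in [U]
    fixes the status of a deterministic set of edges. *)
Definition incident_edges e : {set {set 'I_n}} :=
  [set f in E | (f != e) && ~~ [disjoint f & e]].

Lemma incident_edges_sub e : incident_edges e \subset E.
Proof. by apply/subsetP => f; rewrite inE => /andP[]. Qed.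

Definition isolated_edges U : {set {set 'I_n}} :=
  [set e in U | [disjoint incident_edges e & U]].

Lemma isolated_edges_sub U : isolated_edges U \subset U.
Proof. by apply/subsetP => e; rewrite inE => /andP[]. Qed.

Lemma isolated_edges_disjoint U e f : U \subset E ->
  e \in isolated_edges U -> f \in U -> f != e -> [disjoint f & e].
Proof.
move=> UE; rewrite inE => /andP[_ /disjointFl de] fU fe.
have := de _ fU; rewrite inE (subsetP UE _ fU) fe /=.
by move/negbFE.
Qed.

(** The edges of [J] are added one at a time: each is disjoint from every other edge of [U], so each
    costs exactly one. *)
Lemma independence_number_isolated U G J : U \subset E ->
    J \subset isolated_edges U -> G \subset U :\: isolated_edges U ->
  (independence_number (G :|: J) + #|J| = independence_number G)%N.
Proof.
move=> UE + GU; move: {2}#|J| (erefl #|J|) => k.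
elim: k J => [|k IH] J Jk JI.
  by move/eqP: Jk; rewrite cards_eq0 => /eqP ->; rewrite setU0 cards0 addn0.
have [e eJ] : exists e, e \in J by apply/card_gt0P; rewrite Jk.
have eI := subsetP JI e eJ.
have Jk' : #|J :\ e| = k by have := cardsD1 e J; rewrite eJ Jk => -[].
have JI' : J :\ e \subset isolated_edges U by apply: subset_trans JI; rewrite subD1set.
have GJU : G :|: (J :\ e) \subset U.
  rewrite subUset (subset_trans GU) ?subsetDl //.
  exact: subset_trans JI' (isolated_edges_sub U).
rewrite -(IH _ Jk' JI') Jk Jk' -(@independence_number_add_isolated (G :|: (J :\ e)) e).
- by rewrite setUCA setD1K // addnS addSn.
- by rewrite (subsetP UE) // (subsetP (isolated_edges_sub U)).
- exact: subset_trans UE.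
- move=> f fGJ; apply: (isolated_edges_disjoint UE eI); first exact: (subsetP GJU).
  apply: contraTneq fGJ => ->; rewrite !inE eqxx orbF.
  by apply: contraTN eI => /(subsetP GU); rewrite inE => /andP[].
Qed.

Lemma card_subgraphs_independence U k : U \subset E ->
  (#|[set G in powerset U | independence_number G == k]| ^ 2
     * #|isolated_edges U|.+1 <= 4 ^ #|U|)%N.
Proof.
move=> UE; set A := [set G in _ | _]; set I := isolated_edges U.
have IU : I \subset U := isolated_edges_sub U.
set m := #|I|.
(* With the part [H] outside [I] fixed, the independence number determines how many edges of [I] are
   kept. If [k] exceeds the value at [H], the fiber is empty and truncated subtraction gives the
   harmless bound C(m, 0) = 1. *)
have fiber H : H \in powerset (U :\: I) ->
    (#|[set G in A | G :\: I == H]| <= 'C(m, independence_number H - k))%N.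
  rewrite powersetE => HU.
  rewrite -cards_draws -/I.
  set B := [set G in A | _].
  have inj : {in B &, injective (fun G => G :&: I)}.
    move=> G G'; rewrite !inE => /andP[_ /eqP h] /andP[_ /eqP h'] hI.
    by rewrite -(setID G I) -(setID G' I) hI h h'.
  rewrite -(card_in_imset inj); apply: subset_leq_card.
  apply/subsetP => _ /imsetP[G + ->]; rewrite !inE.
  case/andP=> /andP[GU /eqP <-] /eqP HE; rewrite subsetIr /=.
  have HG : H :|: G :&: I = G by rewrite -HE setUC setID.
  have := independence_number_isolated UE (subsetIr G _) HU.
  by rewrite HG => <-; rewrite addKn.
have le : (#|A| <= 2 ^ (#|U| - m) * 'C(m, m./2))%N.
  rewrite -sum1_card.
  rewrite (partition_big (fun G => G :\: I) (mem (powerset (U :\: I)))) /=; last first.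
    by move=> G; rewrite !inE => /andP[GU _]; apply: setSD.
  have <- : #|powerset (U :\: I)| = (2 ^ (#|U| - m))%N.
    by rewrite card_powerset cardsD (setIidPr IU).
  rewrite -sum_nat_const; apply: leq_sum => H HU.
  apply: leq_trans (bin_le_half _ (independence_number H - k)).
  by apply: leq_trans (fiber H HU); rewrite -sum1_card leq_eqVlt; apply/orP; left;
    apply/eqP/eq_bigl => G; rewrite !inE.
have mU : (m <= #|U|)%N by apply: subset_leq_card.
apply: (@leq_trans ((2 ^ (#|U| - m) * 'C(m, m./2)) ^ 2 * m.+1)).
  by rewrite leq_mul2r leq_exp2r // le orbT.
have -> : (4 ^ #|U| = (2 ^ (#|U| - m)) ^ 2 * 4 ^ m)%N.
  by rewrite -expnM [(_ * 2)%N]mulnC expnM -[(2 ^ 2)%N]/4%N -expnD subnK.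
by rewrite expnMn -mulnA leq_mul2l bin_sqr_le orbT.
Qed.

Lemma card_incident_edges e : e \in E -> (#|incident_edges e| <= 2 * n)%N.
Proof.
rewrite inE => /eqP e2.
apply: (@leq_trans #|[set [set u.1; u.2] | u in setX e [set: 'I_n]]|).
  apply/subset_leq_card/subsetP => f; rewrite !inE => /and3P[f2 _ /pred0Pn[x /= /andP[xf xe]]].
  have /cards2P[y [z [_ fE]]] := f2.
  apply/imsetP; move: xf; rewrite fE in_set2 => /orP[]/eqP xE; subst x.
    by exists (y, z); rewrite ?inE ?xe.
  by exists (z, y); rewrite ?inE ?xe // setUC.
by apply: leq_trans (leq_imset_card _ _) _; rewrite cardsX e2 cardsT card_ord.
Qed.

(** An edge meeting both of the disjoint edges [e] and [f] joins an endpoint of one to an endpoint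
    of the other. *)
Lemma card_incident_edgesI e f : e \in E -> f \in E -> [disjoint e & f] ->
  (#|incident_edges e :&: incident_edges f| <= 4)%N.
Proof.
rewrite !inE => /eqP e2 /eqP f2 def.
apply: (@leq_trans #|[set [set u.1; u.2] | u in setX e f]|); last first.
  by apply: leq_trans (leq_imset_card _ _) _; rewrite cardsX e2 f2.
apply/subset_leq_card/subsetP => g; rewrite !inE.
case/andP=> /and3P[g2 _ /pred0Pn[x /= /andP[xg xe]]].
case/and3P=> [_ _ /pred0Pn[y /= /andP[yg yf]]].
apply/imsetP; exists (x, y); rewrite ?inE ?xe //=.
apply/esym/eqP; rewrite eqEcard (eqP g2) subUset !sub1set xg yg /= cards2.
by rewrite (_ : x != y) //; apply: contraTneq xe => ->; rewrite (disjointFl def).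
Qed.
End Graph.

(** * Product weights, two-round exposure and Chebyshev's inequality *)

Section RandomGraph.
Set Implicit Arguments.
Variables (R : realType) (n : nat).
Implicit Types (p q : R) (e f : {set 'I_n}) (F G U : {set {set 'I_n}}).
Local Notation E := (potential_edges n).

(** Distributivity: expanding the product on the right decides, edge by edge, whether the edge is in
    [U]. Events and sums over product weights are evaluated through this identity. *)
Lemma sum_graphs_prod (f g : {set 'I_n} -> R) :
  \sum_(U in graphs n) \prod_(e in E) (if e \in U then f e else g e)
    = \prod_(e in E) (f e + g e).
Proof.
(* Off [E] the values 0 and 1 kill every [U] with a non-edge and leave the other products
   unchanged. *)
pose f' e := if e \in E then f e else 0; pose g' e := if e \in E then g e else 1.
have -> : \prod_(e in E) (f e + g e) = \prod_e (f' e + g' e).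
  rewrite big_mkcond; apply: eq_bigr => e _; rewrite /f' /g'.
  by case: ifP; rewrite ?add0r.
rewrite bigA_distr big_mkcond; apply: eq_bigr => U _; rewrite powersetE.
case: ifP => [/subsetP UE|/negbT/subsetPn[e eU eE]]; last first.
  by rewrite (bigD1 e) //= eU /f' (negPf eE) mul0r.
rewrite big_mkcond; apply: eq_bigr => e _; rewrite /f' /g'.
by case: (boolP (e \in E)) => // eE; case: ifP => // /UE; rewrite (negPf eE).
Qed.

Lemma Gnp_weight_ge0 p U : 0 <= p <= 1 -> 0 <= Gnp_weight p U.
Proof.
by case/andP=> p0 p1; apply: prodr_ge0 => e _; case: ifP; rewrite ?subr_ge0.
Qed.

Lemma sum_Gnp_weight p : \sum_(U in graphs n) Gnp_weight p U = 1.
Proof. by rewrite sum_graphs_prod big1 // => e _; rewrite subrKC. Qed.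

Lemma Gnp_prob_pattern p F1 F2 : F1 \subset E -> F2 \subset E ->
    [disjoint F1 & F2] ->
  Gnp_prob p (fun U => (F1 \subset U) && [disjoint F2 & U])
    = p ^+ #|F1| * (1 - p) ^+ #|F2|.
Proof.
move=> F1E F2E dF.
(* The event is encoded in the weights: a forbidden status of an edge gets factor 0. *)
transitivity (\sum_(U in graphs n) \prod_(e in E)
    (if e \in U then if e \in F2 then 0 else p
                else if e \in F1 then 0 else 1 - p)).
  rewrite /Gnp_prob big_mkcondr; apply: eq_bigr => U _.
  case: ifP => [/andP[/subsetP F1U d2]|/negbT/nandP[]].
  - apply: eq_bigr => e _; case: ifP => eU; first by rewrite (disjointFl d2 eU).
    by rewrite (contraFF (F1U e) eU).
  - case/subsetPn => e eF eU; rewrite (bigD1 e) ?(subsetP F1E) //=.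
    by rewrite (negPf eU) eF mul0r.
  - case/pred0Pn => e /= /andP[eF eU]; rewrite (bigD1 e) ?(subsetP F2E) //=.
    by rewrite eU eF mul0r.
rewrite sum_graphs_prod.
transitivity (\prod_(e in E) ((if e \in F1 then p else 1)
                              * (if e \in F2 then 1 - p else 1))).
  apply: eq_bigr => e _; case: (boolP (e \in F1)) => [eF|_].
    by rewrite (disjointFr dF eF) addr0 mulr1.
  by case: ifP; rewrite ?add0r ?mul1r ?subrKC.
rewrite big_split /= -!big_mkcondr -!prodr_const.
by congr (_ * _); apply: eq_bigl => e; apply: andb_idl; apply/subsetP.
Qed.

Lemma Gnp_weight_thinning p G : G \subset E ->
  Gnp_weight p G
    = \sum_(U in graphs n | G \subset U) Gnp_weight (2 * p) U * 2 ^- #|U|.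
Proof.
move=> GE.
(* Factors per edge: 2p * 1/2 = p if it is in [U]; otherwise 1 - 2p, or 0 if [G] needs it. They add
   up to p on [G] and to 1 - p off [G]. *)
transitivity (\sum_(U in graphs n) \prod_(e in E)
    (if e \in U then p else if e \in G then 0 else 1 - 2 * p)); last first.
  rewrite [RHS]big_mkcondr; apply: eq_bigr => U; rewrite powersetE => UE.
  case: ifP => [/subsetP GU|/negbT/subsetPn[e eG eU]]; last first.
    by rewrite (bigD1 e) ?(subsetP GE) //= (negPf eU) eG mul0r.
  have -> : 2 ^- #|U| = \prod_(e in E) (if e \in U then 2^-1 else 1) :> R.
    rewrite -exprVn -prodr_const -big_mkcondr.
    by apply: eq_bigl => e; symmetry; apply: andb_idl; apply/subsetP.
  rewrite -big_split /=; apply: eq_bigr => e _; case: ifP => eU.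
    by rewrite mulrAC divff ?mul1r // pnatr_eq0.
  by rewrite (contraFF (GU e) eU) mulr1.
rewrite sum_graphs_prod; apply: eq_bigr => e _.
by case: ifP => _; ring.
Qed.

(** Total probability over the first round: given [U], the kept graph is uniform among the subsets
    of [U]. *)
Lemma Gnp_prob_thinning p (A : pred {set {set 'I_n}}) :
  Gnp_prob p A = \sum_(U in graphs n) Gnp_weight (2 * p) U
    * (#|[set G in powerset U | A G]|%:R / 2 ^+ #|U|).
Proof.
transitivity (\sum_(G in graphs n | A G) \sum_(U in graphs n | G \subset U)
    Gnp_weight (2 * p) U * 2 ^- #|U|).
  apply: eq_bigr => G /andP[GE _]; apply: Gnp_weight_thinning.
  by rewrite powersetE in GE.
rewrite (exchange_big_dep (mem (graphs n))) /=; last by move=> G U _ /andP[].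
apply: eq_bigr => U UE; rewrite powersetE in UE.
rewrite sumr_const -[LHS]mulr_natr -mulrA [X in _ = _ * X]mulrC.
congr (_ * (_ * _%:R)); apply: eq_card => G.
rewrite [RHS]inE powersetE [LHS]unfold_in /= !powersetE UE.
by case: (boolP (G \subset U)) => GU; rewrite ?andbF //= (subset_trans GU UE) andbT.
Qed.

Lemma Gnp_chebyshev_lower p (X : {set {set 'I_n}} -> R) (t : R) :
  0 <= p <= 1 -> 0 <= t ->
  t ^+ 2 * Gnp_prob p (fun U => X U < \sum_(U in graphs n) Gnp_weight p U * X U - t)
    <= \sum_(U in graphs n) Gnp_weight p U * X U ^+ 2
       - (\sum_(U in graphs n) Gnp_weight p U * X U) ^+ 2.
Proof.
move=> p01 t0; set mu := \sum_(U in graphs n) _.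
have -> : \sum_(U in graphs n) Gnp_weight p U * X U ^+ 2 - mu ^+ 2
  = \sum_(U in graphs n) Gnp_weight p U * (X U - mu) ^+ 2.
  (* The square is expanded around the mean; total mass 1 gives the variance identity. *)
  rewrite [RHS](eq_bigr (fun U => Gnp_weight p U * X U ^+ 2
      + (- 2 * mu * (Gnp_weight p U * X U) + mu ^+ 2 * Gnp_weight p U))).
    by rewrite !big_split /= -!mulr_sumr sum_Gnp_weight -/mu; ring.
  by move=> U _; ring.
rewrite /Gnp_prob mulr_sumr big_mkcondr; apply: ler_sum => U _.
have w0 : 0 <= Gnp_weight p U by apply: Gnp_weight_ge0.
case: ifP => [lt|_]; last by rewrite mulr_ge0 // sqr_ge0.
rewrite mulrC ler_wpM2l //.
by rewrite -[leRHS]sqrrN opprB lerXn2r ?nnegrE; lra.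
Qed.

(** * First and second moments of the number of isolated edges *)

Local Notation iso_prob q e := (Gnp_prob q (fun U => e \in isolated_edges U)).

Lemma isolated_prob q e : e \in E ->
  iso_prob q e = q * (1 - q) ^+ #|incident_edges e|.
Proof.
move=> eE; have e1E : [set e] \subset E by rewrite sub1set.
have de : [disjoint [set e] & incident_edges e] by rewrite disjoints1 inE eqxx andbF.
rewrite -[X in X * _]expr1 -(cards1 e).
rewrite -(Gnp_prob_pattern q e1E (incident_edges_sub e) de).
rewrite /Gnp_prob; apply: eq_bigl => U.
by rewrite sub1set [e \in isolated_edges U]inE.
Qed.

(** Near independence: edges that meet are never both isolated, and for disjoint edges the two sets
    of forbidden edges share at most 4 elements, which the factor [(1 - q) ^+ 4] compensates. *)
Lemma isolated_prob2 q e f : 0 <= q <= 1 -> e \in E -> f \in E -> f != e ->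
  Gnp_prob q (fun U => (e \in isolated_edges U) && (f \in isolated_edges U))
    * (1 - q) ^+ 4 <= iso_prob q e * iso_prob q f.
Proof.
move=> /andP[q0 q1] eE fE fe; have q'0 : 0 <= 1 - q by rewrite subr_ge0.
rewrite !isolated_prob //.
case: (boolP [disjoint e & f]) => def; last first.
  rewrite /Gnp_prob big_pred0 => [|U]; first by rewrite mul0r !mulr_ge0 ?exprn_ge0.
  apply/negbTE/negP => /and3P[_ + /(subsetP (isolated_edges_sub U)) fU].
  rewrite inE => /andP[_ /disjointFl /(_ fU)].
  by rewrite inE fE fe disjoint_sym def.
have -> : Gnp_prob q (fun U => (e \in isolated_edges U) && (f \in isolated_edges U))
    = q ^+ 2 * (1 - q) ^+ #|incident_edges e :|: incident_edges f|.
  rewrite -[2%N]/(true.+1) -fe eq_sym -cards2.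
  have efE : [set e; f] \subset E by rewrite subUset !sub1set eE.
  have inE' : incident_edges e :|: incident_edges f \subset E.
    by rewrite subUset !incident_edges_sub.
  have d : [disjoint [set e; f] & incident_edges e :|: incident_edges f].
    rewrite disjoint_subset; apply/subsetP => g; rewrite in_set2 => gef.
    rewrite !inE; case/orP: gef => /eqP ->;
      by rewrite eqxx ?def ?(disjoint_sym f) ?def ?andbF.
  rewrite -(Gnp_prob_pattern q efE inE' d).
  rewrite /Gnp_prob; apply: eq_bigl => U; congr (_ && _); rewrite !inE subUset !sub1set.
  by rewrite andbACA -!setI_eq0 setIUl setU_eq0.
rewrite [leRHS]mulrACA -expr2 -mulrA -!exprD ler_wpM2l ?sqr_ge0 //.
apply: ler_wiXn2l => //; first by lra.
by rewrite -cardsUI leq_add2l card_incident_edgesI.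
Qed.

Lemma isolated_mean q :
  \sum_(U in graphs n) Gnp_weight q U * #|isolated_edges U|%:R
    = \sum_(e in E) iso_prob q e.
Proof.
rewrite /Gnp_prob.
rewrite [RHS](exchange_big_dep (mem (graphs n))) /=; last by move=> e U _ /andP[].
apply: eq_bigr => U UE; rewrite sumr_const mulr_natr.
congr (_ *+ _); apply: eq_card => e; rewrite [RHS]unfold_in /= UE.
rewrite andb_idl //; apply/subsetP; apply: subset_trans (isolated_edges_sub _) _.
by rewrite powersetE in UE.
Qed.

Lemma isolated_second_moment q :
  \sum_(U in graphs n) Gnp_weight q U * #|isolated_edges U|%:R ^+ 2
    = \sum_(e in E) \sum_(f in E)
       Gnp_prob q (fun U => (e \in isolated_edges U) && (f \in isolated_edges U)).
Proof.
have card_iso U : U \in graphs n ->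
    #|isolated_edges U|%:R = \sum_(e in E) (e \in isolated_edges U)%:R :> R.
  rewrite powersetE => UE; rewrite -sum1_card natr_sum big_mkcond [RHS]big_mkcond.
  apply: eq_bigr => e _; case: (boolP (e \in isolated_edges U)) => [eI|_].
    by rewrite (subsetP UE) // (subsetP (isolated_edges_sub U)).
  by rewrite if_same.
rewrite (eq_bigr (fun U => \sum_(e in E) \sum_(f in E) Gnp_weight q U
  * ((e \in isolated_edges U) && (f \in isolated_edges U))%:R)).
  rewrite exchange_big; apply: eq_bigr => e _; rewrite exchange_big.
  apply: eq_bigr => f _; rewrite /Gnp_prob [RHS]big_mkcondr; apply: eq_bigr => U _.
  by case: ifP => _; rewrite ?mulr1 ?mulr0.
move=> U UE; rewrite card_iso // expr2 big_distrlr mulr_sumr.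
apply: eq_bigr => e _; rewrite mulr_sumr; apply: eq_bigr => f _.
by rewrite -mulnb natrM.
Qed.

Lemma isolated_variance q : 0 <= q <= 1 ->
  let mu := \sum_(U in graphs n) Gnp_weight q U * #|isolated_edges U|%:R in
  (\sum_(U in graphs n) Gnp_weight q U * #|isolated_edges U|%:R ^+ 2)
    * (1 - q) ^+ 4 <= mu + mu ^+ 2.
Proof.
move=> q01; have /andP[q0 q1] := q01; rewrite /=; set mu := \sum_(U in graphs n) _ * _%:R.
have w0 (A : pred {set {set 'I_n}}) : 0 <= Gnp_prob q A.
  by apply: sumr_ge0 => U _; apply: Gnp_weight_ge0.
rewrite isolated_second_moment /mu isolated_mean mulr_suml.
rewrite expr2 mulr_suml -big_split /=; apply: ler_sum => e eE.
(* The diagonal terms sum to at most the mean, the others to at most its square. *)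
rewrite (bigD1 e) //= mulrDl; apply: lerD.
- rewrite (_ : Gnp_prob q _ = iso_prob q e); last first.
    by rewrite /Gnp_prob; apply: eq_bigl => U; rewrite andbb.
  by apply: ler_piMr => //; apply: exprn_ile1; lra.
- rewrite mulr_suml mulr_sumr [leRHS](bigD1 e) //=.
  rewrite ler_wpDl ?mulr_ge0 //; apply: ler_sum => f /andP[fE fe].
  exact: isolated_prob2.
Qed.

Lemma isolated_mean_ge q : 0 <= q <= 1 ->
  'C(n, 2)%:R * (q * (1 - q) ^+ (2 * n))
    <= \sum_(U in graphs n) Gnp_weight q U * #|isolated_edges U|%:R.
Proof.
move=> /andP[q0 q1]; rewrite isolated_mean.
have -> : 'C(n, 2) = #|E|.
  have := cards_draws [set: 'I_n] 2; rewrite cardsT card_ord => <-.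
  by apply: eq_card => e; rewrite !inE subsetT.
rewrite mulr_natl -sumr_const; apply: ler_sum => e eE.
rewrite isolated_prob // ler_wpM2l //; apply: ler_wiXn2l; rewrite ?card_incident_edges //; lra.
Qed.

(** * Atoms of the independence number and the lower tail of the isolated edges *)

Lemma independence_number_prob_le p k (t : R) : 0 <= 2 * p <= 1 -> 0 < t ->
  Gnp_prob p (fun G => independence_number G == k)
    <= Gnp_prob (2 * p) (fun U => #|isolated_edges U|%:R < t) + (Num.sqrt t)^-1.
Proof.
move=> p01 t0; rewrite Gnp_prob_thinning.
have st0 : 0 < Num.sqrt t by rewrite sqrtr_gt0.
(* Total mass 1 spreads the error term over all [U], so the comparison is made for each [U]: few
   isolated edges use [b <= 1], many use [bm]. *)
rewrite -[X in _ + X]mul1r -[X in _ + X / _](sum_Gnp_weight (2 * p)) mulr_suml.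
rewrite /Gnp_prob big_mkcondr -big_split /=; apply: ler_sum => U UE.
rewrite powersetE in UE.
have w0 : 0 <= Gnp_weight (2 * p) U by apply: Gnp_weight_ge0.
have := card_subgraphs_independence k UE.
set a := #|[set G in _ | _]|; set m := #|isolated_edges U| => am.
have p2 : 0 < 2 ^+ #|U| :> R by rewrite exprn_gt0.
set b := a%:R / 2 ^+ #|U|.
have b0 : 0 <= b by rewrite divr_ge0 // ltW.
have bm : b ^+ 2 * m.+1%:R <= 1.
  rewrite /b expr_div_n mulrAC ler_pdivrMr ?exprn_gt0 // mul1r.
  by rewrite -exprM mulnC exprM -!natrX -natrM ler_nat -[(2 ^ 2)%N]/4%N.
case: ifP => [_|/negbT].
  have b1 : b <= 1.
    rewrite -ler_sqr ?nnegrE // expr1n; apply: le_trans bm.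
    by rewrite ler_peMr ?sqr_ge0 // ler1n.
  by rewrite -[X in X <= _]addr0 lerD ?ler_piMr // mulr_ge0 // invr_ge0 ltW.
rewrite -leNgt => tm; rewrite add0r ler_wpM2l //.
have bt0 : 0 <= b * Num.sqrt t by rewrite mulr_ge0 // ltW.
rewrite -[leRHS]mul1r ler_pdivlMr // -ler_sqr ?nnegrE ?ler01 //.
rewrite expr1n exprMn sqr_sqrtr ?(ltW t0) //; apply: le_trans bm.
by rewrite ler_wpM2l ?sqr_ge0 // (le_trans tm) // ler_nat.
Qed.

Lemma isolated_tail q : 0 <= q <= 8^-1 ->
  let mu := \sum_(U in graphs n) Gnp_weight q U * #|isolated_edges U|%:R in
  0 < mu ->
  Gnp_prob q (fun U => #|isolated_edges U|%:R < mu / 2) <= 8 / mu + 32 * q.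
Proof.
move=> q8; have /andP[q0 q1] := q8.
have q01 : 0 <= q <= 1 by lra.
rewrite /=; have := isolated_variance q q01; rewrite /=.
set mu := \sum_(U in graphs n) _ * _%:R; set M := \sum_(U in graphs n) _ => HM mu0.
have := @Gnp_chebyshev_lower q (fun U => #|isolated_edges U|%:R) (mu / 2) q01.
rewrite -/mu -/M (_ : mu - mu / 2 = mu / 2); last by lra.
set P := Gnp_prob _ _; move=> /(_ _) HP.
have {}HP : (mu / 2) ^+ 2 * P <= M - mu ^+ 2 by apply: HP; lra.
have M0 : 0 <= M.
  apply: sumr_ge0 => U _; rewrite mulr_ge0 ?sqr_ge0 //; exact: Gnp_weight_ge0.
have q4 : 1 - 4 * q <= (1 - q) ^+ 4.
  rewrite (_ : (1 - q) ^+ 4 = 1 - 4 * q + q ^+ 2 * (6 - 4 * q + q ^+ 2)); last by ring.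
  by rewrite lerDl mulr_ge0 ?sqr_ge0 //; have := sqr_ge0 q; lra.
have HM1 : M * (1 - 4 * q) <= mu + mu ^+ 2.
  by apply: le_trans HM; rewrite ler_wpM2l.
(* Here [q <= 1/8] enters: (1 - 4q)(1 + 8q) = 1 + 4q(1 - 8q) >= 1. *)
have HM2 : M <= (mu + mu ^+ 2) * (1 + 8 * q).
  apply: (@le_trans _ _ (M * (1 - 4 * q) * (1 + 8 * q))).
    rewrite -mulrA ler_peMr //; nra.
  by rewrite ler_wpM2r //; lra.
have mq : mu * q <= mu / 8 by rewrite ler_wpM2l // ltW.
rewrite -(ler_pM2l (exprn_gt0 2 mu0)).
rewrite (_ : mu ^+ 2 * (8 / mu + 32 * q) = 8 * mu + 32 * (mu ^+ 2 * q)); last first.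
  by field; rewrite gt_eqF.
nra.
Qed.

End RandomGraph.

(** * Estimates for p = c/n and conclusion *)

Lemma expR_le_1B (R : realType) (q : R) : 0 <= q <= 2^-1 ->
  expR (- (2 * q)) <= 1 - q.
Proof.
move=> /andP[q0 q1]; have e0 := expR_gt0 (2 * q).
rewrite expRN -[leLHS]mul1r ler_pdivrMr //.
(* It suffices that (1 - q)(1 + 2q) = 1 + q(1 - 2q) >= 1. *)
have := expR_ge1Dx (2 * q); nra.
Qed.

Lemma isolated_mean_linear (R : realType) (c : R) (n : nat) : 0 < c ->
    2 <= n%:R :> R -> 16 * c <= n%:R ->
  c / 2 * expR (- (8 * c)) * n%:R <=
   \sum_(U in graphs n) Gnp_weight (2 * (c / n%:R)) U * #|isolated_edges U|%:R.
Proof.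
move=> c0 n2 nc; have n0 : 0 < n%:R :> R by lra.
set q := 2 * (c / n%:R).
have qn : q * n%:R = 2 * c by rewrite /q; field; rewrite gt_eqF.
have q8 : 0 <= q <= 8^-1.
  by apply/andP; split; rewrite -(ler_pM2r n0) ?mul0r qn; lra.
have q01 : 0 <= q <= 1 by lra.
apply: le_trans (isolated_mean_ge R n q q01).
(* The exponent is 2n * 2q = 4qn = 8c. *)
have e1 : expR (- (8 * c)) <= (1 - q) ^+ (2 * n).
  rewrite (_ : - (8 * c) = (2 * n)%:R * - (2 * q)); last first.
    by rewrite natrM; ring: qn.
  by rewrite expRM_natl lerXn2r ?nnegrE ?expR_ge0 ?expR_le_1B //; lra.
have cn : n%:R * n%:R / 4 <= 'C(n, 2)%:R :> R.
  have : n%:R * (n%:R - 1) = 2 * 'C(n, 2)%:R :> R.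
    have h := mul_bin_left n 1; rewrite bin1 in h.
    have n1 : (1 <= n)%N by rewrite -(ltr0n R).
    by rewrite -natrM h natrM natrB // mulrC.
  nra.
have e0 := expR_gt0 (- (8 * c)).
apply: (@le_trans _ _ (n%:R * n%:R / 4 * (q * expR (- (8 * c))))).
  rewrite le_eqVlt; apply/orP; left; apply/eqP.
  rewrite (_ : n%:R * n%:R / 4 * _ = (q * n%:R) * expR (- (8 * c)) * n%:R / 4); last by ring.
  by rewrite qn; field.
apply: ler_pM => //; first by rewrite divr_ge0 // mulr_ge0 // ltW.
  by rewrite mulr_ge0 ?expR_ge0 //; lra.
by rewrite ler_wpM2l //; lra.
Qed.

Theorem theorem12 (R : realType) (c : R) (k : nat -> int) :
  0 < c ->
  exists L : R, 0 < L /\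
    exists N : nat, forall n : nat, (N <= n)%N ->
      Gnp_prob (c / n%:R)
        (fun G : {set {set 'I_n}} => (independence_number G)%:Z == k n)
      <= L * n%:R `^ (- (1 / 2)).
Proof.
move=> c0; set d := c / 2 * expR (- (8 * c)).
have d0 : 0 < d by rewrite mulr_gt0 ?expR_gt0 // divr_gt0.
have sd0 : 0 < Num.sqrt (d / 2) by rewrite sqrtr_gt0 divr_gt0.
(* The mean is at least [d * n]. The summands bound, after scaling by the square root of n, the two
   Chebyshev terms [8 / mu] and [32 * q] and the atom term at threshold [mu / 2]. *)
exists (8 / d + 64 * c + (Num.sqrt (d / 2))^-1); split.
  by rewrite !addr_gt0 ?mulr_gt0 ?invr_gt0.
have c16 : 0 <= 16 * c by rewrite mulr_ge0 // ltW.
exists (Num.bound (16 * c)).+2 => n Nn.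
have n2 : 2 <= n%:R :> R by rewrite ler_nat (leq_trans _ Nn).
have nc : 16 * c <= n%:R.
  rewrite ltW // (lt_le_trans (archi_boundP c16)) // ler_nat.
  by rewrite ltnW // ltnW.
have n0 : 0 < n%:R :> R by lra.
rewrite div1r powRN powR12_sqrt ?(ltW n0) //.
set s := Num.sqrt n%:R.
have s0 : 0 < s by rewrite sqrtr_gt0.
have ss : n%:R = s * s by rewrite -expr2 sqr_sqrtr // ltW.
have s1 : 1 <= s by rewrite -[leLHS]sqrtr1 ler_sqrt //; lra.
set q := 2 * (c / n%:R).
have qn : q = 2 * c / (s * s) by rewrite /q -ss mulrA.
have qn' : q * n%:R = 2 * c by rewrite /q; field; rewrite gt_eqF.
have q8 : 0 <= q <= 8^-1.
  by apply/andP; split; rewrite -(ler_pM2r n0) ?mul0r qn'; lra.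
have := isolated_mean_linear R c n c0 n2 nc; rewrite -/d -/q.
have := isolated_tail R n q q8; rewrite /=.
set mu := \sum_(U in graphs n) _ => tail dmu.
have mu0 : 0 < mu by apply: lt_le_trans dmu; rewrite mulr_gt0.
have {}tail := tail mu0.
have q01 : 0 <= q <= 1 by lra.
have m20 : 0 < mu / 2 by rewrite divr_gt0.
have := @independence_number_prob_le R n (c / n%:R) `|k n|%N (mu / 2) q01 m20.
rewrite -/q => bound.
(* Passing to the absolute value only enlarges the event: a negative [k n] is never attained. *)
apply: (@le_trans _ _ (Gnp_prob (c / n%:R) (fun G => independence_number G == `|k n|%N))).
  rewrite /Gnp_prob big_mkcondr [leRHS]big_mkcondr; apply: ler_sum => G _.
  have w0 : 0 <= Gnp_weight (c / n%:R) G by apply: Gnp_weight_ge0; rewrite /q in q01; lra.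
  case: eqP => [<-|_]; first by rewrite absz_nat eqxx.
  by case: ifP.
apply: le_trans bound _; apply: le_trans (lerD tail (lexx _)) _.
(* This term and the next are of order 1/n; [1 <= s] weakens them to order [1 / s]. *)
have t1 : 8 / mu <= 8 / d / s.
  rewrite -[leRHS]mulrA -invfM ler_wpM2l // lef_pV2 ?posrE ?(mulr_gt0 d0) //.
  by apply: le_trans dmu; rewrite ler_wpM2l ?(ltW d0) // ss ler_peMr // ltW.
have t2 : 32 * q <= 64 * c / s.
  rewrite qn (_ : 32 * _ = 64 * c / s * s^-1); last by field; rewrite gt_eqF.
  by rewrite ler_piMr ?invf_le1 // divr_ge0 ?(ltW s0) // mulr_ge0 // ltW.
have t3 : (Num.sqrt (mu / 2))^-1 <= (Num.sqrt (d / 2))^-1 / s.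
  rewrite -invfM lef_pV2 ?posrE ?(mulr_gt0 sd0) ?sqrtr_gt0 //.
  rewrite /s -sqrtrM ?ler_sqrt ?(ltW m20) //; last by rewrite divr_ge0 // ltW.
  by rewrite mulrAC ler_pM2r // invr_gt0.
by rewrite [leRHS]mulrDl [X in _ <= X + _]mulrDl; apply: lerD => //; apply: lerD.
Qed.
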